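(* Fix integers $k,N\ge1$. For each prime $p$ let $\Omega(p)$ be a subset of $(\mathbb{Z}/p^N\mathbb{Z})^k$. For $x>0$ and $m\in\mathbb{Z}^k$ put $P(x;m):=\#\{p\le x\text{ prime}: m\bmod p^N\in\Omega(p)\}$ and $P(x):=\sum_{p\le x}\#\Omega(p)\,p^{-Nk}$. Let $B=\prod_{j=1}^k[M_j,M_j+N_j]\subset\mathbb{R}^k$ be a box with $N_j\ge x^{2N}$ for all $j$, and let $V(B)=\prod_jN_j$. Then \[\sum_{m\in B\cap\mathbb{Z}^k}\big(P(x;m)-P(x)\big)^2\le c_{k,N}\,V(B)\,P(x),\] where $c_{k,N}>0$ is a constant depending only on $k$ and $N$. *)

(* Defs.v *)
From HB Require Import structures.
From mathcomp Require Import all_boot all_order all_algebra.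
From mathcomp Require Import boolp classical_sets fsbigop reals.
Set Implicit Arguments. Unset Strict Implicit. Unset Printing Implicit Defensive.
Import Order.TTheory GRing.Theory Num.Theory.
Local Open Scope ring_scope.
Local Open Scope classical_set_scope.

(* Reduction of m in Z^k modulo q, as an element of ('Z_q)^k.
   For q = p^N with p prime, N >= 1, 'Z_q is exactly Z/qZ (q >= 2). *)
Definition redmod (k q : nat) (m : {ffun 'I_k -> int}) : {ffun 'I_k -> 'Z_q} :=
  [ffun j => (m j)%:~R].

Definition Pxm (R : realType) (k N : nat)
    (Omega : forall p : nat, {set {ffun 'I_k -> 'Z_(p ^ N)}})
    (x : R) (m : {ffun 'I_k -> int}) : nat :=
  #|[set p : 'I_(Num.truncn x).+1 |
      prime p && (redmod (p ^ N) m \in Omega p)]|.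

Definition Px (R : realType) (k N : nat)
    (Omega : forall p : nat, {set {ffun 'I_k -> 'Z_(p ^ N)}}) (x : R) : R :=
  \sum_(p < (Num.truncn x).+1 | prime p)
     (#|Omega p|%:R / (p%:R ^+ (N * k))).

Definition box_pts (R : realType) (k : nat) (M L : 'I_k -> R)
    : set {ffun 'I_k -> int} :=
  [set m | forall j, M j <= (m j)%:~R <= M j + L j].

(* Main.v *)
Require Import Defs.
From HB Require Import structures.
From mathcomp Require Import all_boot all_order all_algebra.
From mathcomp Require Import boolp classical_sets fsbigop reals.
From mathcomp Require Import trigo.
From mathcomp Require Import zify ring lra.
Import Order.TTheory GRing.Theory Num.Theory.
Local Open Scope ring_scope.

(** Let [X = trunc x], [Q = X^(2N)] and let [T = Q H], with [H = X!^(2N)]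
    divisible by every [p^N], [p <= X]. On [Z/T] the Fejer kernel with
    frequencies [|l| < H] has exactly the same mass on the translates of any
    progression of difference [d <= Q], hence its [k]-fold tensor power averages
    functions that are periodic modulo [p^N] or [(pq)^N] as a constant weight
    would. Under this weight the events [m mod p^N \in Omega p] are
    therefore exactly pairwise independent by the Chinese remainder theorem, and
    the variance of [P(x; m)] is at most its mean [P(x)]. The weight is at least
    a constant multiple of its maximum on a box of side [Q / 8], and the given
    box, whose sides are at least [Q], is covered by translates of that one. *)

(** * The Fejer kernel modulo [T] *)

Section Trigonometry.
Variable R : realType.

Lemma cosD_pi2n (a : R) (n : nat) : cos (a + pi *+ 2 * n%:R) = cos a.
Proof. by rewrite mulr_natr (periodicn (@cosD2pi R)). Qed.

Lemma sinD_pi2n (a : R) (n : nat) : sin (a + pi *+ 2 * n%:R) = sin a.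
Proof. by rewrite mulr_natr (periodicn (@sinD2pi R)). Qed.

(** Multiplied by [2 sin h], with [h = pi b / T] half the angular step, the sum telescopes between
    two phases that differ by [2 pi b]. Here [0 < h < pi], so [sin h] can be cancelled. *)
Lemma sum_cos_progression (a : R) (b T : nat) : (0 < b < T)%N ->
  \sum_(u < T) cos (a + pi *+ 2 * (b * u)%:R / T%:R) = 0.
Proof.
case/andP=> b0 bT.
have T0 : T%:R != 0 :> R by rewrite pnatr_eq0; lia.
pose h : R := pi * b%:R / T%:R.
have h0 : sin h != 0.
  apply: lt0r_neq0; apply: sin_gt0_pi.
  rewrite /h divr_gt0 ?mulr_gt0 ?pi_gt0 ?ltr0n //=; last by lia.
  rewrite ltr_pdivrMr ?ltr0n; last by lia.
  by rewrite ltr_pM2l ?pi_gt0 // ltr_nat.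
pose S u : R := sin (a - h + h *+ 2 * u%:R).
apply: (mulfI (mulf_neq0 (_ : 2%:R != 0) h0)); first by rewrite pnatr_eq0.
rewrite mulr0 mulr_sumr.
transitivity (\sum_(0 <= u < T) (S u.+1 - S u)).
  rewrite big_mkord; apply: eq_bigr => u _; rewrite /S.
  have -> : a + pi *+ 2 * (b * u)%:R / T%:R = a + h *+ 2 * u%:R.
    by rewrite /h natrM; field.
  rewrite (_ : a - h + h *+ 2 * u.+1%:R = a + h *+ 2 * u%:R + h); last first.
    by rewrite -natr1; ring.
  rewrite (_ : a - h + h *+ 2 * u%:R = a + h *+ 2 * u%:R - h); last by ring.
  by rewrite sinD sinB; ring.
rewrite telescope_sumr // /S mulr0 addr0.
rewrite (_ : h *+ 2 * T%:R = pi *+ 2 * b%:R); last by rewrite /h; field.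
by rewrite sinD_pi2n subrr.
Qed.

(** Since [cos (2x) >= 0], the duplication formula gives [cos x ^ 2 >= 1/2], which is more than
    enough. *)
Lemma cos_ge_half (x : R) : 0 <= x <= pi / 4 -> 1 / 2 <= cos x.
Proof.
case/andP=> x0 x4; have p0 := pi_gt0 R.
have c0 : 0 <= cos x by apply: cos_ge0_pihalf; lra.
have : 0 <= cos (x *+ 2) by apply: cos_ge0_pihalf; lra.
rewrite cos_mulr2n; nra.
Qed.

(** Squared modulus of the exponential sum of [e(hn/T)] over [h < H], in real form: [H] times the
    usual Fejer kernel. *)
Definition fejer (T H n : nat) : R :=
  (\sum_(h < H) cos (pi *+ 2 * (h * n)%:R / T%:R)) ^+ 2 +
  (\sum_(h < H) sin (pi *+ 2 * (h * n)%:R / T%:R)) ^+ 2.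

Lemma fejer_ge0 T H n : 0 <= fejer T H n.
Proof. by rewrite addr_ge0 // sqr_ge0. Qed.

Lemma fejer_mod T H n : (0 < T)%N -> fejer T H (n %% T) = fejer T H n.
Proof.
move=> T0; have T0' : T%:R != 0 :> R by rewrite pnatr_eq0; lia.
have E h : pi *+ 2 * (h * n)%:R / T%:R =
   pi *+ 2 * (h * (n %% T))%:R / T%:R + pi *+ 2 * (h * (n %/ T))%:R :> R.
  rewrite {1}(divn_eq n T) !natrM natrD natrM; field.
  exact: T0'.
by rewrite /fejer; congr (_ ^+ 2 + _ ^+ 2); apply: eq_bigr => h _;
  rewrite E ?cosD_pi2n ?sinD_pi2n.
Qed.

(* The frequencies of the Fejer kernel are h - h' with |h - h'| < H; multiplied
   by d they stay strictly between -T and T, so only h = h' survives. *)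
Lemma sum_fejer_progression T H d a : (0 < d)%N -> (H * d <= T)%N ->
  \sum_(u < T) fejer T H (a + u * d) = (H * T)%:R.
Proof.
move=> d0 HdT.
pose ang h u : R := pi *+ 2 * (h * (a + u * d))%:R / T%:R.
have E u : fejer T H (a + u * d) =
    \sum_(h < H) \sum_(h' < H) cos (ang h u - ang h' u).
  rewrite /fejer !expr2 !mulr_suml -big_split; apply: eq_bigr => h _ /=.
  rewrite !mulr_sumr -big_split; apply: eq_bigr => h' _ /=.
  by rewrite cosB.
have Z h h' : (h' < h < H)%N -> \sum_(u < T) cos (ang h u - ang h' u) = 0.
  case/andP=> hh hH.
  have b0 : (0 < (h - h') * d < T)%N by apply/andP; split; nia.
  rewrite -[RHS](sum_cos_progression (pi *+ 2 * ((h - h') * a)%:R / T%:R) _ _ b0).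
  apply: eq_bigr => u _; congr cos; rewrite /ang -mulrBl -mulrBr -mulrDl -mulrDr.
  rewrite -natrB ?leq_mul2r ?(ltnW hh) ?orbT // -natrD.
  by congr (_ * _%:R / _); rewrite -mulnBl; lia.
under eq_bigr do rewrite E.
rewrite exchange_big /=.
transitivity (\sum_(h < H) T%:R : R); last first.
  by rewrite sumr_const card_ord natrM mulr_natl.
apply: eq_bigr => h _; rewrite exchange_big /= (bigD1 h) //=.
rewrite [X in _ + X]big1 ?addr0 => [|h' h'h].
  by under eq_bigr do rewrite subrr cos0; rewrite sumr_const card_ord.
have [lt|] := ltnP h' h; first by apply: Z; rewrite lt ltn_ord.
rewrite leq_eqVlt eq_sym (inj_eq val_inj) (negPf h'h) /= => lt.
under eq_bigr do rewrite -cosN opprB.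
by apply: Z; rewrite lt ltn_ord.
Qed.

(** All phases [2 pi h n / T] lie in [[0, pi/4]], so every cosine is at least 1/2; the square of the
    sine sum is dropped. *)
Lemma fejer_ge T H n : (0 < T)%N -> (8 * (H * n) <= T)%N ->
  H%:R ^+ 2 / 4 <= fejer T H n.
Proof.
move=> T0 le; apply: (@le_trans _ _
  ((\sum_(h < H) cos (pi *+ 2 * (h * n)%:R / T%:R)) ^+ 2)); last first.
  by rewrite lerDl sqr_ge0.
have -> : H%:R ^+ 2 / 4 = (H%:R / 2) ^+ 2 :> R by field.
have ge_half : H%:R / 2 <= \sum_(h < H) cos (pi *+ 2 * (h * n)%:R / T%:R) :> R.
  have -> : H%:R / 2 = \sum_(h < H) (1 / 2) :> R.
    by rewrite sumr_const card_ord mul1r -[RHS]mulr_natl.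
  apply: ler_sum => h _; apply: cos_ge_half.
  have p0 := pi_gt0 R; apply/andP; split.
    by rewrite divr_ge0 ?ler0n // mulr_ge0 ?ler0n // mulrn_wge0 ?pi_ge0.
  rewrite ler_pdivrMr ?ltr0n //.
  have : 8 * (h * n)%:R <= T%:R :> R.
    rewrite -natrM ler_nat; apply: leq_trans le; rewrite leq_mul2l leq_mul2r.
    by rewrite (ltnW (ltn_ord h)) orbT.
  nra.
by rewrite lerXn2r ?nnegrE ?divr_ge0 // (le_trans _ ge_half) ?divr_ge0.
Qed.
End Trigonometry.

(** * Equidistribution and variance on a finite set *)

(** Injections between fibres in both directions force all fibres to have the same size. Below, [s]
    is always a translation of the torus. *)
Lemma card_preim_equifibred (G K : finType) (f : G -> K) (S : {set K}) :
  (forall y y', exists2 s : G -> G, injective s &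
     forall g, f g = y -> f (s g) = y') ->
  (#|[set g | f g \in S]| * #|K| = #|S| * #|G|)%N.
Proof.
move=> equi; pose F y := #|[set g | f g == y]|.
have Fle y y' : (F y <= F y')%N.
  have [s s_inj sE] := equi y y'.
  rewrite /F -(card_imset _ s_inj); apply: subset_leq_card.
  apply/fintype.subsetP => _ /imsetP[g + ->]; rewrite !inE => /eqP fg.
  by apply/eqP; apply: sE.
have FE y y' : F y = F y' by apply/eqP; rewrite eqn_leq !Fle.
have count (A : {set K}) : #|[set g | f g \in A]| = (\sum_(y in A) F y)%N.
  rewrite -sum1_card (partition_big f (mem A)) /=; last first.
    by move=> g; rewrite inE.
  apply: eq_bigr => y yA; rewrite /F -sum1_card; apply: eq_bigl => g.
  by rewrite !inE andbC; case: eqP => // ->.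
have [y0 _|K0] := pickP (fun _ : K => true); last first.
  rewrite (eq_card0 K0) muln0 (_ : #|S| = 0%N) //.
  by apply: eq_card0 => y; have := K0 y.
rewrite count (eq_bigr _ (fun y _ => FE y y0)) sum_nat_const -mulnA; congr muln.
have := count [set: K]; rewrite (eq_bigr _ (fun y _ => FE y y0)) sum_nat_const.
by rewrite cardsT mulnC => <-; apply: eq_card => g; rewrite !inE.
Qed.

(* The second moment about [mu] is [sum W n^2 - mu^2 kap |G|]; pairwise
   independence cancels the [mu^2] terms, leaving the diagonal. *)
Lemma weighted_variance_le (R : realFieldType) (G I : finType) (P : pred I)
    (A : I -> {set G}) (W : G -> R) (kap : R) :
  (0 < #|G|)%N -> 0 <= kap ->
  \sum_g W g = kap * #|G|%:R ->
  (forall p, P p -> \sum_(g in A p) W g = kap * #|A p|%:R) ->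
  (forall p q, P p -> P q -> p != q ->
     \sum_(g in A p :&: A q) W g = kap * (#|A p|%:R * #|A q|%:R / #|G|%:R)) ->
  \sum_g W g * (#|[set p | P p && (g \in A p)]|%:R -
                \sum_(p | P p) #|A p|%:R / #|G|%:R) ^+ 2 <=
    kap * \sum_(p | P p) #|A p|%:R.
Proof.
move=> G0 kap0 W1 WA WAA.
have G0' : #|G|%:R != 0 :> R by rewrite pnatr_eq0 -lt0n.
pose M : R := \sum_(p | P p) #|A p|%:R; rewrite -/M -mulr_suml -/M.
set mu := M / #|G|%:R.
pose n g : R := #|[set p | P p && (g \in A p)]|%:R.
have nE g : n g = \sum_(p | P p) (g \in A p)%:R.
  rewrite /n -sum1_card natr_sum (eq_bigl _ _ (finset.in_set _)) big_mkcondr /=.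
  by apply: eq_bigr => p _; case: (g \in A p).
have Wn : \sum_g W g * n g = kap * M.
  under eq_bigr do rewrite nE mulr_sumr.
  rewrite exchange_big mulr_sumr; apply: eq_bigr => p Pp.
  rewrite -WA // [RHS]big_mkcond; apply: eq_bigr => g _ /=.
  by case: (g \in _); rewrite ?mulr1 ?mulr0.
have Wn2 : \sum_g W g * n g ^+ 2 <= kap * M + kap * (M * M / #|G|%:R).
  have -> : \sum_g W g * n g ^+ 2 =
      \sum_(p | P p) \sum_(q | P q) \sum_(g in A p :&: A q) W g.
    under eq_bigr do rewrite nE expr2 big_distrlr /= mulr_sumr.
    rewrite exchange_big; apply: eq_bigr => p _ /=.
    under eq_bigr do rewrite mulr_sumr.
    rewrite exchange_big; apply: eq_bigr => q _ /=.
    rewrite [RHS]big_mkcond; apply: eq_bigr => g _; rewrite inE.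
    by case: (g \in A p); case: (g \in A q); rewrite ?mulr1 ?mulr0.
  have -> : kap * (M * M / #|G|%:R) =
      \sum_(p | P p) kap * (#|A p|%:R * M / #|G|%:R).
    by rewrite -mulr_sumr -!mulr_suml.
  rewrite {1}/M mulr_sumr -big_split.
  apply: ler_sum => p Pp /=.
  rewrite (bigD1 p) //= finset.setIid WA //; apply: lerD => //.
  (* The product [M * M] also contains the term [q = p]; it is nonnegative, so including it only
     weakens the bound. *)
  rewrite /M mulr_sumr mulr_suml mulr_sumr [leRHS](bigD1 p) //=.
  rewrite [X in X <= _](eq_bigr (fun q => kap * (#|A p|%:R * #|A q|%:R / #|G|%:R)));
    last by move=> q /andP[Pq qp]; apply: WAA; rewrite // eq_sym.
  by rewrite lerDr mulr_ge0 // !mulr_ge0 ?invr_ge0.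
have -> : \sum_g W g * (n g - mu) ^+ 2 =
    \sum_g W g * n g ^+ 2 - mu *+ 2 * (\sum_g W g * n g) + mu ^+ 2 * \sum_g W g.
  rewrite !mulr_sumr -sumrB -big_split; apply: eq_bigr => g _ /=; ring.
rewrite Wn W1 /mu -lerBrDr -lerBrDr opprK.
apply: le_trans Wn2 _; rewrite le_eqVlt; apply/orP; left; apply/eqP; field.
exact: G0'.
Qed.

(** * The tensor-power Fejer weight and residues on the torus *)

Section Torus.
Variables (R : realType) (k t : nat).
Local Notation T := t.+1.
Local Notation G := {ffun 'I_k -> 'I_T}.

(** The modulus is a successor so that ['I_T] carries the additive group of Z/T, and [G] that of its
    [k]-th power. *)
Definition fejer_weight (H : nat) (g : G) : R := \prod_j fejer R T H (g j).

Lemma fejer_weight_ge0 H g : 0 <= fejer_weight H g.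
Proof. by apply: prodr_ge0 => j _; apply: fejer_ge0. Qed.

Lemma val_addMn (a u : 'I_T) d : val (a + u *+ d) = ((a + u * d) %% T)%N.
Proof.
have -> : u *+ d = inord ((u * d) %% T) :> 'I_T.
  apply: val_inj => /=; rewrite inordK ?ltn_mod //.
  elim: d => [|d IHd]; first by rewrite muln0 mod0n.
  by rewrite mulrS /= IHd modnDmr mulnS.
by rewrite /= inordK ?ltn_mod // modnDmr.
Qed.

(* Averaging over the translations u d replaces the weight by its mean. *)
Lemma sum_fejer_weight (H d : nat) (phi : G -> R) :
  (0 < d)%N -> (H * d <= T)%N ->
  (forall g u : G, phi (g + u *+ d) = phi g) ->
  \sum_g fejer_weight H g * phi g = H%:R ^+ k * \sum_g phi g.
Proof.
move=> d0 HdT per.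
have T0 : T%:R ^+ k != 0 :> R by rewrite expf_neq0 // pnatr_eq0.
have mean (g : G) : \sum_(u : G) fejer_weight H (g + u *+ d) = (H * T)%:R ^+ k.
  under eq_bigr => u _.
    rewrite /fejer_weight.
    under eq_bigr => j _ do rewrite ffunE ffunMnE val_addMn fejer_mod //.
    over.
  rewrite -(bigA_distr_bigA (fun j (u : 'I_T) => fejer R T H (g j + u * d))) /=.
  rewrite (eq_bigr (fun=> (H * T)%:R)) ?prodr_const ?card_ord // => j _.
  by rewrite sum_fejer_progression.
apply: (mulfI T0).
transitivity (\sum_(u : G) \sum_(g : G) fejer_weight H (g + u *+ d) * phi g).
  have -> : T%:R ^+ k = #|{: G}|%:R :> R by rewrite card_ffun !card_ord natrX.
  rewrite mulr_natl -sumr_const; apply: eq_bigr => u _.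
  have shift_inj : injective (fun g : G => g + u *+ d) by apply: addIr.
  rewrite (reindex_inj shift_inj); apply: eq_bigr => g _ /=.
  by rewrite per.
rewrite exchange_big mulrA -exprMn mulrC -natrM mulnC mulr_suml /=.
by apply: eq_bigr => g _; rewrite -mulr_suml mean mulrC mulnC.
Qed.

Lemma sum_fejer_weight_set (H d : nat) (A : {set G}) :
  (0 < d)%N -> (H * d <= T)%N ->
  (forall g u : G, (g + u *+ d \in A) = (g \in A)) ->
  \sum_(g in A) fejer_weight H g = H%:R ^+ k * #|A|%:R.
Proof.
move=> d0 HdT per.
have := sum_fejer_weight H d (fun g => (g \in A)%:R) d0 HdT.
have -> : \sum_g (g \in A)%:R = #|A|%:R :> R.
  by rewrite -natr_sum -sum1_card [in RHS]big_mkcond.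
move=> <-; last by move=> g u; rewrite per.
rewrite big_mkcond; apply: eq_bigr => g _.
by case: (_ \in _); rewrite ?mulr1 ?mulr0.
Qed.

Definition torus_red (q : nat) (g : G) : {ffun 'I_k -> 'Z_q} :=
  [ffun j => (g j : nat)%:R].

Lemma natr_Zp_mod q n : (1 < q)%N -> (q %| T)%N -> (n %% T)%:R = n%:R :> 'Z_q.
Proof.
move=> q1 /dvdnP[c Tc]; rewrite {2}(divn_eq n T) natrD natrM Tc natrM.
by rewrite pchar_Zp // !mulr0 add0r.
Qed.

Lemma torus_redD q (g u : G) d : (1 < q)%N -> (q %| T)%N ->
  torus_red q (g + u *+ d) = torus_red q g + torus_red q u *+ d.
Proof.
move=> q1 qT; apply/ffunP => j; rewrite !ffunE !ffunMnE !ffunE val_addMn.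
by rewrite natr_Zp_mod // natrD natrM mulr_natr.
Qed.

(** Translation by a lift of [y' - y] to the torus carries the fibre over [y] into the fibre over
    [y']. *)
Lemma card_torus_red q (S : {set {ffun 'I_k -> 'Z_q}}) :
  (1 < q)%N -> (q %| T)%N ->
  (#|[set g : G | torus_red q g \in S]| * q ^ k = #|S| * T ^ k)%N.
Proof.
move=> q1 qT.
have cK : #|{: {ffun 'I_k -> 'Z_q}}| = (q ^ k)%N.
  by rewrite card_ffun !card_ord Zp_cast.
have cG : #|{: G}| = (T ^ k)%N by rewrite card_ffun !card_ord.
rewrite -cK -cG; apply: card_preim_equifibred => y y'.
pose z : {ffun 'I_k -> 'Z_q} := (y' : {ffun 'I_k -> 'Z_q}) - y.
(* The default of [inord] never occurs: [z j < q <= T]. *)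
pose u : G := [ffun j => inord (z j)].
have uE : torus_red q u = z.
  apply/ffunP => j; rewrite !ffunE inordK ?natr_Zp //.
  apply: leq_trans (dvdn_leq _ qT) => //.
  exact: leq_trans (ltn_ord _) (eq_leq (Zp_cast q1)).
(* The multiple [u *+ 1] matches the form of [torus_redD]. *)
exists (fun g : G => g + u *+ 1); first exact: addIr.
by move=> g gy; rewrite torus_redD // uE mulr1n gy /z addrC subrK.
Qed.

(** By the Chinese remainder theorem a single translation realises prescribed differences modulo
    both [q1] and [q2], so the pair of reductions is equidistributed too. This is the exact pairwise
    independence. *)
Lemma card_torus_red_coprime q1 q2 (S1 : {set {ffun 'I_k -> 'Z_q1}})
    (S2 : {set {ffun 'I_k -> 'Z_q2}}) :
  (1 < q1)%N -> (1 < q2)%N -> (q1 %| T)%N -> (q2 %| T)%N -> coprime q1 q2 ->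
  (#|[set g : G | (torus_red q1 g \in S1) && (torus_red q2 g \in S2)]|
     * (q1 ^ k * q2 ^ k) = #|S1| * #|S2| * T ^ k)%N.
Proof.
move=> q1_gt1 q2_gt1 q1T q2T co.
have cK q : (1 < q)%N -> #|{: {ffun 'I_k -> 'Z_q}}| = (q ^ k)%N.
  by move=> ?; rewrite card_ffun !card_ord Zp_cast.
have cG : #|{: G}| = (T ^ k)%N by rewrite card_ffun !card_ord.
rewrite -cG -(cK q1) // -(cK q2) // -card_prod -cardsX.
rewrite -(card_preim_equifibred _ _ (fun g => (torus_red q1 g, torus_red q2 g))).
  by congr muln; apply: eq_card => g; rewrite !inE.
move=> [y1 y2] [y1' y2'].
pose z1 : {ffun 'I_k -> 'Z_q1} := (y1' : {ffun 'I_k -> 'Z_q1}) - y1.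
pose z2 : {ffun 'I_k -> 'Z_q2} := (y2' : {ffun 'I_k -> 'Z_q2}) - y2.
pose c j := chinese q1 q2 (z1 j) (z2 j).
(* Reduction modulo [T] keeps both residues, as [q1] and [q2] divide [T]. *)
pose u : G := [ffun j => inord (c j %% T)].
have uE1 : torus_red q1 u = z1.
  apply/ffunP => j; rewrite ffunE ffunE inordK ?ltn_mod // natr_Zp_mod //.
  rewrite -[RHS]natr_Zp -(Zp_nat_mod q1_gt1) chinese_modl //.
  by rewrite Zp_nat_mod.
have uE2 : torus_red q2 u = z2.
  apply/ffunP => j; rewrite ffunE ffunE inordK ?ltn_mod // natr_Zp_mod //.
  rewrite -[RHS]natr_Zp -(Zp_nat_mod q2_gt1) chinese_modr //.
  by rewrite Zp_nat_mod.
exists (fun g : G => g + u *+ 1); first exact: addIr.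
move=> g [g1 g2]; rewrite !torus_redD // uE1 uE2 !mulr1n g1 g2 /z1 /z2.
by congr pair; rewrite addrC subrK.
Qed.
End Torus.

(** * The second moment over one small cube *)

Section Moment.
Variables (R : realType) (k N t : nat).
Local Notation T := t.+1.
Local Notation G := {ffun 'I_k -> 'I_T}.

Lemma torus_red_dvd q d (g u : G) : (1 < q)%N -> (q %| T)%N -> (q %| d)%N ->
  torus_red k t q (g + u *+ d) = torus_red k t q g.
Proof.
move=> q1 qT /dvdnP[c ->]; rewrite torus_redD //; apply/ffunP => j.
by rewrite !ffunE ffunMnE -[X in _ + X]mulr_natr natrM pchar_Zp // !mulr0 addr0.
Qed.

(** Lifts the torus to Z^k through the representatives [0, ..., T - 1], with the origin placed at
    [b]. *)
Definition int_shift (b : {ffun 'I_k -> int}) (g : G) : {ffun 'I_k -> int} :=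
  [ffun j => b j + (g j : nat)%:Z].

Lemma redmod_int_shift q b g :
  redmod q (int_shift b g) = torus_red k t q g + redmod q b.
Proof.
by apply/ffunP => j; rewrite !ffunE rmorphD /= addrC.
Qed.

Variables (Omega : forall p : nat, {set {ffun 'I_k -> 'Z_(p ^ N)}}).
Variable X : nat.
Local Notation Q := (X ^ (2 * N))%N.
Local Notation H := (X`! ^ (2 * N))%N.

(** [hits] and [density] are [Pxm] and [Px] with the truncation of [x] replaced by the natural
    number [X]. *)
Definition hits (m : {ffun 'I_k -> int}) : nat :=
  #|[set p : 'I_X.+1 | prime p && (redmod (p ^ N) m \in Omega p)]|.

Definition density : R :=
  \sum_(p < X.+1 | prime p) (#|Omega p|%:R / p%:R ^+ (N * k)).

(** On the cube the weight is at least [(H^2/4)^k], while the weighted variance is at most [H^k T^k]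
    times the density. Per coordinate the quotient is [(4/H^2) * H * (Q H) = 4 Q]. *)
Lemma translate_moment (b : {ffun 'I_k -> int}) :
  (0 < X)%N -> (0 < N)%N -> T = (Q * H)%N ->
  \sum_(g : G | [forall j, (g j < (Q %/ 8).+1)%N])
     ((hits (int_shift b g))%:R - density) ^+ 2
  <= (4 * Q%:R) ^+ k * density.
Proof.
move=> X0 N0 TE.
have Q0 : (0 < Q)%N by rewrite expn_gt0 X0.
have H0 : (0 < H)%N by rewrite expn_gt0 fact_gt0.
have H0' : H%:R != 0 :> R by rewrite pnatr_eq0 -lt0n.
have cG : #|{: G}| = (T ^ k)%N by rewrite card_ffun !card_ord.
(* The shift by [b] is absorbed into the residue set; being a translation, it does not change its
   cardinality. *)
pose A (p : 'I_X.+1) : {set G} :=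
  [set g : G | torus_red k t (p ^ N) g \in
     (fun r : {ffun 'I_k -> 'Z_(p ^ N)} => r + redmod (p ^ N) b) @^-1: Omega p].
have pN1 p : prime p -> (1 < p ^ N)%N.
  by move=> pp; rewrite -(exp1n N) ltn_exp2r // prime_gt1.
have pNT (p : 'I_X.+1) : prime p -> (p ^ N %| T)%N.
  move=> pp; rewrite TE dvdn_mull // mulnC expnM dvdn_mulr // ?dvdn_exp2r //.
  by rewrite dvdn_fact // prime_gt0 //= -ltnS.
have pNQ (p : 'I_X.+1) : (p ^ N <= X ^ N)%N by rewrite leq_exp2r // -ltnS.
have XNQ : (X ^ N * X ^ N <= Q)%N by rewrite mul2n -addnn expnD.
have cA (p : 'I_X.+1) : prime p ->
    (#|A p| * (p ^ N) ^ k = #|Omega p| * T ^ k)%N.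
  by move=> pp; rewrite card_torus_red ?pN1 ?pNT // card_preimset //; apply: addIr.
have cAA (p q : 'I_X.+1) : prime p -> prime q -> p != q ->
    (#|A p :&: A q| * T ^ k = #|A p| * #|A q|)%N.
  move=> pp pq npq.
  have co : coprime (p ^ N) (q ^ N).
    by rewrite coprimeXl ?coprimeXr ?prime_coprime // dvdn_prime2.
  have := card_torus_red_coprime _ _ _ _
    ((fun r : {ffun 'I_k -> 'Z_(p ^ N)} => r + redmod (p ^ N) b) @^-1: Omega p)
    ((fun r : {ffun 'I_k -> 'Z_(q ^ N)} => r + redmod (q ^ N) b) @^-1: Omega q)
    (pN1 _ pp) (pN1 _ pq) (pNT _ pp) (pNT _ pq) co.
  rewrite !card_preimset; try exact: addIr.
  rewrite (_ : #|_| = #|A p :&: A q|); last first.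
    by apply: eq_card => g; rewrite !inE.
  move=> e.
  have : (0 < (p ^ N) ^ k * (q ^ N) ^ k)%N.
    by rewrite muln_gt0 !expn_gt0 !prime_gt0.
  move=> c0; apply/eqP; rewrite -(eqn_pmul2r c0); apply/eqP.
  rewrite [RHS]mulnACA !cA // mulnAC e; lia.
have AE g : hits (int_shift b g) = #|[set p : 'I_X.+1 | prime p && (g \in A p)]|.
  by apply: eq_card => p; rewrite !inE redmod_int_shift.
have muE : density = \sum_(p : 'I_X.+1 | prime p) #|A p|%:R / #|{: G}|%:R.
  apply: eq_bigr => p pp; rewrite cG.
  apply/eqP; rewrite eqr_div ?expf_neq0 ?pnatr_eq0 -?lt0n ?expn_gt0 ?(prime_gt0 pp) //.
  by rewrite -natrX -!natrM expnM cA.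
have WA (p : 'I_X.+1) : prime p ->
    \sum_(g in A p) fejer_weight R k t H g = H%:R ^+ k * #|A p|%:R.
  move=> pp.
  rewrite (sum_fejer_weight_set _ _ _ _ (p ^ N)) ?expn_gt0 ?prime_gt0 //.
  - rewrite TE mulnC leq_mul2r; apply/orP; right.
    apply: leq_trans (pNQ p) (leq_trans _ XNQ); rewrite leq_pmulr //.
    by rewrite expn_gt0 X0.
  - by move=> g u; rewrite !inE torus_red_dvd // ?pN1 ?pNT.
have WAA (p q : 'I_X.+1) : prime p -> prime q -> p != q ->
    \sum_(g in A p :&: A q) fejer_weight R k t H g =
    H%:R ^+ k * (#|A p|%:R * #|A q|%:R / #|{: G}|%:R).
  move=> pp pq npq.
  (* The joint event has period [p^N q^N <= X^(2N) = Q], and [H Q = T] is the limit for exact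
     averaging. The exponent [2N] comes from here. *)
  rewrite (sum_fejer_weight_set _ _ _ _ (p ^ N * q ^ N)).
  - rewrite -natrM -cAA // cG natrM mulfK // pnatr_eq0 -lt0n expn_gt0 //.
  - by rewrite muln_gt0 !expn_gt0 !prime_gt0.
  - rewrite TE mulnC leq_mul2r; apply/orP; right.
    by apply: leq_trans XNQ; apply: leq_mul.
  - move=> g u; rewrite !inE !torus_red_dvd // ?pN1 ?pNT //.
      exact: dvdn_mull.
    exact: dvdn_mulr.
have W1 : \sum_g fejer_weight R k t H g = H%:R ^+ k * #|{: G}|%:R.
  rewrite -cardsT.
  rewrite -(sum_fejer_weight_set R k t H 1 [set: G]) ?muln1 ?TE ?leq_pmull //.
    by apply: eq_bigl => g; rewrite inE.
  by move=> g u; rewrite !inE.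
have G0 : (0 < #|{: G}|)%N by rewrite cG expn_gt0.
have := weighted_variance_le R _ _ (fun p : 'I_X.+1 => prime p) A
  (fejer_weight R k t H) (H%:R ^+ k) G0 (exprn_ge0 _ (ler0n _ _)) W1 WA WAA.
rewrite -muE => var.
(* The bound on [g j] means [8 g j <= Q], hence [8 H g j <= T], as [fejer_ge] requires. The rescaled
   weight thus dominates the indicator of the cube. *)
have Wlb (g : G) : [forall j, (g j < (Q %/ 8).+1)%N] ->
    1 <= (4 / H%:R ^+ 2) ^+ k * fejer_weight R k t H g.
  move=> /forallP gs.
  have lb : (H%:R ^+ 2 / 4) ^+ k <= fejer_weight R k t H g.
    rewrite -[X in _ ^+ X](card_ord k) -prodr_const; apply: ler_prod => j _.
    rewrite divr_ge0 ?exprn_ge0 //=; apply: fejer_ge => //.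
    have gj : (8 * g j <= Q)%N.
      by rewrite (leq_trans _ (leq_divM Q 8)) // mulnC leq_mul2r -ltnS gs orbT.
    apply: leq_trans (eq_leq (esym TE)).
    by rewrite mulnCA mulnC leq_mul2r gj orbT.
  apply: le_trans (ler_wpM2l _ lb); last by rewrite exprn_ge0 // divr_ge0 ?sqr_ge0.
  by rewrite -exprMn mulrA divfK ?expf_neq0 // divff ?expr1n // pnatr_eq0.
apply: (@le_trans _ _ ((4 / H%:R ^+ 2) ^+ k *
    \sum_g fejer_weight R k t H g * ((hits (int_shift b g))%:R - density) ^+ 2)).
  rewrite big_mkcond mulr_sumr; apply: ler_sum => g _.
  case: ifP => [/Wlb W_ge|_]; last first.
    rewrite mulr_ge0 //; first by rewrite exprn_ge0 // divr_ge0 ?sqr_ge0.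
    by rewrite mulr_ge0 ?fejer_weight_ge0 ?sqr_ge0.
  by rewrite mulrA ler_peMl // sqr_ge0.
under eq_bigr do rewrite AE.
apply: le_trans (ler_wpM2l _ var) _.
  by rewrite exprn_ge0 // divr_ge0 ?sqr_ge0.
have -> : \sum_(p : 'I_X.+1 | prime p) #|A p|%:R = density * (Q * H)%:R ^+ k.
  by rewrite muE -mulr_suml cG natrX -TE divfK // expf_neq0 // pnatr_eq0.
rewrite !mulrA [leLHS]mulrAC -!exprMn.
rewrite ler_wpM2r //; first by apply: sumr_ge0 => p _; rewrite divr_ge0 ?exprn_ge0.
rewrite le_eqVlt; apply/orP; left; apply/eqP; congr (_ ^+ k).
by rewrite natrM; field.
Qed.
End Moment.

(** * Covering the box by translated cubes *)

(** After exchanging sums, each index [i] pays for at most one point, [f i]. The argument rests on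
    [s] being duplicate free and contained in [A], which also holds for the empty list that stands
    for an infinite support. *)
Lemma fsum_le_cover (R : numDomainType) (U : choiceType) (I : finType)
    (P : pred I) (f : I -> U) (A : set U) (F : U -> R) :
  (forall m, 0 <= F m) -> (forall m, A m -> exists2 i, P i & f i = m) ->
  \sum_(m \in A) F m <= \sum_(i | P i) F (f i).
Proof.
move=> F0 cover; set s := finite_support _ _ _.
have s_uniq : uniq s by apply: finite_support_uniq.
have sA m : m \in s -> A m.
  by rewrite /s; case: finite_supportP => // X XA _ _; apply: XA.
apply: (@le_trans _ _
  (\sum_(m <- s) \sum_(i | P i) if f i == m then F (f i) else 0)).
  rewrite !big_seq; apply: ler_sum => m /sA /cover[i Pi fi].
  rewrite (bigD1 i) //= fi eqxx lerDl; apply: sumr_ge0 => j _.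
  by case: ifP.
rewrite exchange_big; apply: ler_sum => i _ /=.
rewrite -big_mkcond (eq_bigl (pred1 (f i))); last by move=> m; rewrite /= eq_sym.
have [fs|fNs] := boolP (f i \in s).
  by rewrite -big_filter filter_pred1_uniq // big_seq1.
rewrite -big_filter (eq_in_filter (a2 := pred0)) ?filter_pred0 ?big_nil //.
by move=> m ms; apply: contraNF fNs => /eqP <-.
Qed.

Section Cover.
Variables (R : realType) (k t s : nat) (M L : 'I_k -> R).
Hypotheses (s_gt0 : (0 < s)%N) (s_le : (s <= t.+1)%N) (L_ge0 : forall j, 0 <= L j).

(** Euclidean division by [s] of the offset from the ceiling of [M j]: the quotients select the
    cube, the remainders the point in it. Each coordinate has at most [L j / s + 1] quotients. *)
Lemma fsum_box_pts_le (F : {ffun 'I_k -> int} -> R) (C : R) :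
  (forall m, 0 <= F m) ->
  (forall b, \sum_(g : {ffun 'I_k -> 'I_t.+1} | [forall j, (g j < s)%N])
               F (int_shift k t b g) <= C) ->
  \sum_(m \in box_pts M L) F m <= C * \prod_j (L j / s%:R + 1).
Proof.
move=> F0 FC.
pose r j := (Num.truncn (L j) %/ s)%N.
(* A non-dependent function type needs one range for all coordinates; [inr] cuts it back to
   [r j]. *)
pose rmax := \max_j r j.
pose base (u : {ffun 'I_k -> 'I_rmax.+1}) : {ffun 'I_k -> int} :=
  [ffun j => Num.ceil (M j) + (s * u j)%:Z].
pose inr (u : {ffun 'I_k -> 'I_rmax.+1}) := [forall j, (u j <= r j)%N].
pose ins (g : {ffun 'I_k -> 'I_t.+1}) := [forall j, (g j < s)%N].
have C0 : 0 <= C by apply: le_trans (FC 0); apply: sumr_ge0.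
apply: (@le_trans _ _ (\sum_(i | inr i.1 && ins i.2)
   F (int_shift k t (base i.1) i.2))).
  apply: (fsum_le_cover R _ _ (fun i => inr i.1 && ins i.2)
    (fun i => int_shift k t (base i.1) i.2)) => // m mB.
  pose n j := `|m j - Num.ceil (M j)|%N.
  have nE j : (n j)%:Z = m j - Num.ceil (M j).
    have /andP[Mm _] := mB j.
    by rewrite /n gez0_abs // subr_ge0 ceil_le_int.
  have n_le j : (n j <= Num.truncn (L j))%N.
    have /andP[_ mL] := mB j.
    rewrite truncn_ge_nat // -[_%:R]/((n j)%:~R) nE rmorphB /=.
    have := ceil_ge (M j); lra.
  have u_le j : (n j %/ s <= r j)%N by apply: leq_div2r.
  have us j : (n j %/ s < rmax.+1)%N.
    by apply: leq_trans (u_le j) _; apply: (leq_bigmax j).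
  have ns j : (n j %% s < t.+1)%N by apply: leq_trans s_le; rewrite ltn_mod.
  exists ([ffun j => inord (n j %/ s)], [ffun j => inord (n j %% s)]).
    by apply/andP; split; apply/forallP => j; rewrite /= ffunE inordK ?ltn_mod.
  apply/ffunP => j; rewrite !ffunE /= !inordK //.
  by rewrite -addrA -PoszD mulnC -divn_eq nE addrC subrK.
rewrite -(pair_big inr ins (fun u g => F (int_shift k t (base u) g))) /=.
apply: (@le_trans _ _ (\sum_(u | inr u) C)); first by apply: ler_sum.
have -> : \sum_(u | inr u) C = C * \prod_j (r j).+1%:R.
  rewrite -[C in LHS]mulr1 -mulr_sumr; congr (C * _).
  rewrite (eq_bigr (fun j => \sum_(u < rmax.+1 | (u <= r j)%N) 1)); last first.
    move=> j _; transitivity (\sum_(u < (r j).+1) 1 : R).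
      by rewrite sumr_const card_ord.
    by apply: (big_ord_widen _ (fun=> 1)); rewrite ltnS (leq_bigmax j).
  rewrite bigA_distr_big_dep.
  by apply: eq_big => [u|u _]; [apply: eq_forallb | rewrite big1].
apply: ler_wpM2l => //; apply: ler_prod => j _; rewrite ler0n /=.
rewrite -natr1 lerD2r ler_pdivlMr ?ltr0n // -natrM.
apply: le_trans (_ : (Num.truncn (L j))%:R <= _); last by rewrite truncn_le.
by rewrite ler_nat leq_divM.
Qed.
End Cover.

(** * Choice of parameters and the final constant *)

Local Open Scope classical_set_scope.

Theorem theorem5p3 (R : realType) (k N : nat) (hk : (1 <= k)%N) (hN : (1 <= N)%N) :
  exists c : R, 0 < c /\
    forall (Omega : forall p : nat, {set {ffun 'I_k -> 'Z_(p ^ N)}})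
           (x : R) (M L : 'I_k -> R),
      0 < x ->
      (forall j, x ^+ (2 * N) <= L j) ->
      \sum_(m \in box_pts M L)
          ((Pxm Omega x m)%:R - Px Omega x) ^+ 2
        <= c * (\prod_j L j) * Px Omega x.
Proof.
(* Per coordinate [36 = 4 * (8 + 1)]: the moment bound gives [4 Q], and [L/s + 1 <= 8 L/Q + L/Q]
   because [Q <= 8 s] and [Q <= L]. *)
exists (36%:R ^+ k); split=> [|Omega x M L x0 hL].
  by rewrite exprn_gt0 ?ltr0n.
set X := Num.truncn x.
have Px_ge0 : 0 <= Px Omega x.
  by apply: sumr_ge0 => p _; rewrite divr_ge0 ?exprn_ge0.
have L_ge0 j : 0 <= L j by apply: le_trans (hL j); rewrite exprn_ge0 ?ltW.
(* [Pxm] counts a classical set and [hits] a finite set, so the two memberships have to be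
   matched. *)
have PxmE m : Pxm Omega x m = hits k N Omega X m.
  apply: eq_card => p; rewrite [RHS]inE; apply/idP/idP => [|pm].
    by rewrite classical_sets.in_setE.
  by rewrite classical_sets.in_setE.
(* If [x < 1] there is no prime to count and the left side vanishes. *)
have [X0|X_gt0] := posnP X.
  rewrite (_ : \sum_(m \in _) _ = 0) ?mulr_ge0 ?exprn_ge0 ?prodr_ge0 //.
  have small (p : 'I_X.+1) : prime p = false.
    by case: p => -[|p] //=; rewrite X0.
  have Px0 : Px Omega x = 0 by apply: big1 => p; rewrite small.
  apply: big1 => m _; rewrite PxmE Px0 subr0 (_ : hits _ _ _ _ _ = 0%N) ?expr0n //.
  by apply: eq_card0 => p; rewrite !inE small.
pose Q := (X ^ (2 * N))%N; pose H := (X`! ^ (2 * N))%N.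
(* The number of integers [n >= 0] with [8 n <= Q]; the successor gives [Q < 8 s] and keeps [s]
   positive when [Q < 8]. *)
pose s := (Q %/ 8).+1.
have Q0 : (0 < Q)%N by rewrite expn_gt0 X_gt0.
have H0 : (0 < H)%N by rewrite expn_gt0 fact_gt0.
have TE : (Q * H).-1.+1 = (Q * H)%N by rewrite prednK // muln_gt0 Q0.
have sT : (s <= (Q * H).-1.+1)%N.
  rewrite TE; apply: (@leq_trans Q); last by rewrite leq_pmulr.
  by rewrite /s ltn_Pdiv.
have QL j : Q%:R <= L j.
  apply: le_trans (hL j); rewrite /Q natrX.
  by apply: lerXn2r; rewrite ?nnegrE ?ler0n ?truncn_le // ltW.
have sum_le := fsum_box_pts_le R k _ s M L isT sT L_ge0
  (fun m => ((Pxm Omega x m)%:R - Px Omega x) ^+ 2)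
  ((4 * Q%:R) ^+ k * Px Omega x) (fun m => sqr_ge0 _).
apply: le_trans (sum_le _) _.
  move=> b; under eq_bigr do rewrite PxmE.
  exact: translate_moment.
rewrite mulrAC ler_wpM2r //.
have expE (a : R) : a ^+ k = \prod_(j < k) a by rewrite prodr_const card_ord.
rewrite !expE -!big_split; apply: ler_prod => j _ /=.
have Q0' : 0 < Q%:R :> R by rewrite ltr0n.
have s0 : 0 < s%:R :> R by rewrite ltr0n.
have Qs : Q%:R <= 8 * s%:R :> R.
  by rewrite -natrM ler_nat mulnC ltnW // -ltn_divLR.
rewrite mulr_ge0 ?mulr_ge0 ?addr_ge0 ?divr_ge0 //=.
have : L j / s%:R <= 8 * L j / Q%:R.
  rewrite ler_pdivrMr // mulrAC ler_pdivlMr //; have := L_ge0 j; nra.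
have -> : 36 * L j = 4 * Q%:R * (8 * L j / Q%:R + L j / Q%:R).
  by field; rewrite gt_eqF.
move=> le1; rewrite ler_wpM2l ?mulr_ge0 //; apply: lerD => //.
by rewrite ler_pdivlMr // mul1r.
Qed.
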